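(* Let $\{A_1,\dots,A_m\}$ be an $(n,m;k_1,\dots,k_m;\ell)$-RWEDF in a finite abelian group $G$ of order $n$ with $\ell\in\mathbb{Z}$ and $k_1,\dots,k_m$ pairwise coprime. Then $\{A_1,\dots,A_m\}$ is bimodal.
   Context: $G$ is written additively, $G^*=G\setminus\{0\}$. For pairwise disjoint nonempty subsets $A_1,\dots,A_m$ of $G$ and $\delta\in G^*$, let $N_i(\delta)=|\{(a_i,a_j): a_i\in A_i,\ a_j\in A_j \text{ for some } j\neq i,\ a_i-a_j=\delta\}|$. An $(n,m;k_1,\dots,k_m;\ell)$-RWEDF is a collection of pairwise disjoint subsets with $|A_i|=k_i$ such that $\sum_i \frac{1}{k_i}N_i(\delta)=\ell$ for all $\delta\in G^*$. A collection $A_1,\dots,A_m$ of disjoint subsets with $|A_j|=k_j$ is bimodal if $N_j(\delta)\in\{0,k_j\}$ for all $\delta\in G^*$ and all $j$. *)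

(* Defs.v *)
From mathcomp Require Import all_boot all_order all_algebra.

Set Implicit Arguments.
Unset Strict Implicit.
Unset Printing Implicit Defensive.

Import GRing.Theory.
Local Open Scope ring_scope.

Definition disjoint_family (G : finZmodType) (m : nat) (k : 'I_m -> nat)
    (A : 'I_m -> {set G}) : Prop :=
  [/\ forall i, A i != set0,
      forall i j, i != j -> [disjoint A i & A j]
    & forall i, #|A i| = k i].

Definition ndiff (G : finZmodType) (m : nat) (A : 'I_m -> {set G})
    (i : 'I_m) (d : G) : nat :=
  #|[set p : G * G | [&& p.1 \in A i,
                         [exists j : 'I_m, (j != i) && (p.2 \in A j)]
                       & p.1 - p.2 == d]]|.

Definition RWEDF (G : finZmodType) (n m : nat) (k : 'I_m -> nat) (l : rat)
    (A : 'I_m -> {set G}) : Prop :=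
  [/\ #|G| = n,
      disjoint_family k A
    & forall d : G, d != 0 ->
        \sum_(i < m) ((k i)%:R^-1 * (ndiff A i d)%:R) = l].

Definition bimodal (G : finZmodType) (m : nat) (k : 'I_m -> nat)
    (A : 'I_m -> {set G}) : Prop :=
  disjoint_family k A /\
  forall (d : G) (j : 'I_m), d != 0 -> ndiff A j d = 0%N \/ ndiff A j d = k j.

(* Main.v *)
Require Import Defs.
From mathcomp Require Import all_boot all_order all_algebra.

Set Implicit Arguments.
Unset Strict Implicit.
Unset Printing Implicit Defensive.

Import GRing.Theory Num.Theory.
Local Open Scope ring_scope.

(** A sum of fractions with pairwise coprime denominators is an integer only if
    every fraction is: multiply by all denominators but one. Since
    [N_i(d) <= k_i], the only multiples of [k_i] available are [0] and [k_i]. *)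

Lemma dvdn_int_sum_frac (I : finType) (k N : I -> nat) :
  (forall i, 0 < k i)%N -> (forall i j, i != j -> coprime (k i) (k j)) ->
  \sum_i ((k i)%:R^-1 * (N i)%:R) \is a @Num.int rat ->
  forall i, (k i %| N i)%N.
Proof.
move=> k_gt0 co_k sum_int i.
have k_neq0 j : (k j)%:R != 0 :> rat by rewrite pnatr_eq0 -lt0n.
pose P := (\prod_(j | j != i) k j)%N.
have co_iP : coprime (k i) P.
  rewrite /P; elim/big_rec: _ => [|j x ji co_x]; first exact: coprimen1.
  by rewrite coprimeMr co_x co_k // eq_sym.
(* If [P * N i / k i] is an integer [z], then [k i] divides [P * N i], and Gauss's lemma removes the
   coprime factor [P]. The divisibility is checked over the integers because [z] comes as one. *)
suff /intrP[z zE] : P%:R * ((k i)%:R^-1 * (N i)%:R) \is a @Num.int rat.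
  rewrite -(Gauss_dvdr _ co_iP) -[(_ %| _)%N]/((k i)%:Z %| (P * N i)%N%:Z)%Z.
  apply/dvdzP; exists z; apply: (@intr_inj rat).
  by rewrite intrM -zE -!pmulrn natrM [_^-1 * _]mulrC mulrA mulfVK.
(* Both parts of the difference are integers: the full sum is one by hypothesis, and for [j != i]
   the denominator [k j] cancels against a factor of [P]. *)
have -> : P%:R * ((k i)%:R^-1 * (N i)%:R) =
    P%:R * (\sum_j ((k j)%:R^-1 * (N j)%:R))
    - \sum_(j | j != i) P%:R * ((k j)%:R^-1 * (N j)%:R) :> rat.
  by rewrite (bigD1 i) //= mulrDr mulr_sumr addrK.
rewrite rpredB ?rpredM ?rpred_nat // rpred_sum // => j ji.
by rewrite /P (bigD1 j) //= mulnC natrM mulrA mulfK // -natrM rpred_nat.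
Qed.

(** For fixed [d] a counted pair is determined by its first entry [a], its second being [a - d]; so
    the first projection injects the pairs into [A i]. *)
Lemma ndiff_le_card (G : finZmodType) (m : nat) (A : 'I_m -> {set G})
    (i : 'I_m) (d : G) : (ndiff A i d <= #|A i|)%N.
Proof.
rewrite /ndiff; set S := finset _.
rewrite -(@card_in_imset _ _ (fun p : G * G => p.1) S).
  by apply/subset_leq_card/subsetP => _ /imsetP[p + ->]; rewrite inE => /andP[].
move=> [a b] [a' b']; rewrite !inE /= => /and3P[_ _ /eqP bE] /and3P[_ _ /eqP].
by rewrite -bE => + aa'; rewrite -aa' => /addrI/oppr_inj ->.
Qed.

Theorem mainTheorem9 (G : finZmodType) (n m : nat) (k : 'I_m -> nat) (l : rat)
    (A : 'I_m -> {set G})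
    (hA : RWEDF n k l A)
    (hl : l \is a Num.int)
    (hk : forall i j : 'I_m, i != j -> coprime (k i) (k j)) :
  bimodal k A.
Proof.
case: hA => _ famA sumE; split=> // d j d_neq0.
case: famA => A_neq0 _ cardA.
(* Nonempty blocks make the denominators nonzero, so the inverses in [rat] are genuine. *)
have k_gt0 i : (0 < k i)%N by rewrite -cardA card_gt0.
have k_dvd : (k j %| ndiff A j d)%N.
  by apply: (dvdn_int_sum_frac (N := ndiff A ^~ d)); rewrite ?sumE.
have [->|N_gt0] := posnP (ndiff A j d); first by left.
right; apply/eqP; rewrite eqn_leq (dvdn_leq N_gt0 k_dvd) andbT -cardA.
exact: ndiff_le_card.
Qed.
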